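(* Let $J=\{J_0,J_1,\dots,J_s\}$ be a list of subsets $J_p\subseteq G$, and let $\mathcal{C}=\{\mathbf{c}_1,\dots,\mathbf{c}_l\}\subseteq G$ with $l\ge 1$. Then $$\mathrm{reg}_{B,\mathcal{C}}(J)=X\cap Y,$$ where $$X=\bigcap_{\mathbf{d}\in J_0}\bigl(\mathbf{d}+\mathrm{reg}_{B,\mathcal{C}}(S)+\mathbb{N}\mathcal{C}[0]\bigr),\qquad Y=\bigcap_{p=1}^{s}\ \bigcap_{\mathbf{d}\in J_p}\ \bigcap_{j=1}^{l}\bigl(\mathbf{d}-\mathbf{c}_j+\mathrm{reg}_{B,\mathcal{C}}(S)+\mathbb{N}\mathcal{C}[1-p]\bigr).$$
   Context: $K$ is a field, $G$ is a finitely generated abelian group, $S=K[x_1,\dots,x_n]$ is a $G$-graded polynomial $K$-algebra with $\deg x_i=\mathbf{a}_i\in G$, and $B\subset S$ is a $G$-graded ideal. $\mathbb{N}=\mathbb{Z}_{\ge 0}$. For a finite set $\mathcal{C}=\{\mathbf{c}_1,\dots,\mathbf{c}_l\}\subseteq G$, $\mathbb{N}\mathcal{C}$ is the sub-semigroup of $G$ (containing $\mathbf{0}$) generated by $\mathcal{C}$, and for $j\in\mathbb{Z}$ $$\mathbb{N}\mathcal{C}[j]=\bigcup_{\mathbf{w}\in\mathbb{N}^l,\ \sum w_i=|j|}\bigl(\mathrm{sign}(j)(w_1\mathbf{c}_1+\dots+w_l\mathbf{c}_l)+\mathbb{N}\mathcal{C}\bigr),$$ so $\mathbb{N}\mathcal{C}[0]=\mathbb{N}\mathcal{C}$.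 Sums of subsets of $G$ are Minkowski sums; an empty intersection of subsets of $G$ is $G$. For a $G$-graded $S$-module $M$, $H^i_B(M)$ is the ($G$-graded) local cohomology, and $$\mathrm{reg}_{B,\mathcal{C}}(M)=\{\mathbf{m}\in G: H^i_B(M)_{\mathbf{p}}=0\ \text{for all } i\ge 0 \text{ and all } \mathbf{p}\in\mathbf{m}+\mathbb{N}\mathcal{C}[1-i]\}.$$ For a list $J=\{J_0,\dots,J_s\}$ of subsets of $G$ and $i\ge 0$, $$\mathrm{reg}^i_{B,\mathcal{C}}(J)=\Bigl\{\mathbf{m}\in G:\ \mathbf{m}+\mathbb{N}\mathcal{C}[1-i]\subseteq\bigcap_{p=0}^{s}\bigcap_{\mathbf{d}\in J_p}\bigl(\mathbf{d}+\mathrm{reg}_{B,\mathcal{C}}(S)+\mathbb{N}\mathcal{C}[1-i-p]\bigr)\Bigr\},\qquad \mathrm{reg}_{B,\mathcal{C}}(J)=\bigcap_{i\ge 0}\mathrm{reg}^i_{B,\mathcal{C}}(J).$$ *)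

(* Defs.v *)
From mathcomp Require Import all_boot all_order all_algebra.
From mathcomp Require Import mpoly.
From mathcomp Require Import boolp classical_sets.

Set Implicit Arguments.
Unset Strict Implicit.
Unset Printing Implicit Defensive.

Import GRing.Theory.

Local Open Scope classical_set_scope.
Local Open Scope ring_scope.

Section Subsets.
Variable G : zmodType.
Implicit Types A : set G.

Definition minkowski A1 A2 : set G := [set x + y | x in A1 & y in A2].

Definition translate (g : G) A : set G := [set g + x | x in A].

Definition is_submonoid A : Prop :=
  A 0 /\ forall x y, A x -> A y -> A (x + y).

Definition is_subgroup A : Prop :=
  A 0 /\ forall x y, A x -> A y -> A (x - y).

Definition finitely_generated : Prop :=
  exists s : seq G, smallest is_subgroup [set` s] = setT.

End Subsets.

Notation "A :+: B" := (minkowski A B)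
  (at level 50, left associativity) : classical_set_scope.
Notation "g +: A" := (translate g A)
  (at level 48, left associativity) : classical_set_scope.

Section Semigroup.
Variables (G : zmodType) (l : nat) (c : 'I_l -> G).

Definition NC : set G := smallest (@is_submonoid G) (range c).

Definition NCj (j : int) : set G :=
  \bigcup_(w in [set w : 'I_l -> nat | (\sum_i w i)%N = absz j])
    (((\sum_i c i *+ w i) *~ sgz j) +: NC).

End Semigroup.

Section GradedModules.
Variables (K : fieldType) (G : zmodType) (n : nat) (a : 'I_n -> G).
Local Notation S := {mpoly K[n]}.

(* The grading of S with deg x_i = a_i and the constants in degree 0. *)
Definition mon_degree (m : 'X_{1..n}) : G := \sum_i a i *+ m i.

Definition homogeneous (g : G) : set S :=
  [set f | forall m, m \in msupp f -> mon_degree m = g].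

Definition homog_component (g : G) (f : S) : S :=
  \sum_(m <- msupp f | mon_degree m == g) f@_m *: 'X_[m].

(* The unit ideal is allowed, unlike with the library's idealr_closed. *)
Definition is_ideal (B : set S) : Prop :=
  [/\ B 0, forall f h, B f -> B h -> B (f + h) & forall f h, B h -> B (f * h)].

Definition is_graded_ideal (B : set S) : Prop :=
  is_ideal B /\ forall g f, B f -> B (homog_component g f).

(* The last two axioms say that the module is the internal direct sum of its
   graded pieces. *)
Record gradedModule := GradedModule {
  gm_module :> lmodType S;
  piece : G -> set gm_module;
  piece0 : forall g, piece g 0;
  pieceB : forall g x y, piece g x -> piece g y -> piece g (x - y);
  pieceZ : forall g h f x,
    homogeneous g f -> piece h x -> piece (g + h) (f *: x);
  piece_span : forall x, exists2 s : seq gm_module,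
    (forall y, y \in s -> exists g, piece g y) & x = \sum_(y <- s) y;
  piece_indep : forall (s : seq G) (y : G -> gm_module), uniq s ->
    (forall g, piece g (y g)) -> \sum_(g <- s) y g = 0 ->
    forall g, g \in s -> y g = 0
}.

Definition is_graded (M N : gradedModule) (u : {linear M -> N}) : Prop :=
  forall g x, piece g x -> piece g (u x).

(* Injective objects of the category of G-graded S-modules and degree-0
   homomorphisms. *)
Definition graded_injective (I : gradedModule) : Prop :=
  forall (M N : gradedModule) (f : {linear M -> N}) (u : {linear M -> I}),
    is_graded f -> injective f -> is_graded u ->
    exists2 v : {linear N -> I}, is_graded v & forall x, v (f x) = u x.

Record is_injective_resolution (M : gradedModule) (I : nat -> gradedModule)
    (e : {linear M -> I 0%N}) (d : forall i, {linear I i -> I i.+1}) : Prop := {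
  res_injective : forall i, graded_injective (I i);
  res_graded_aug : is_graded e;
  res_graded : forall i, is_graded (d i);
  res_exact_aug : injective e;
  res_exact0 : forall x, d 0%N x = 0 <-> range e x;
  res_exactS : forall i x, d i.+1 x = 0 <-> range (d i) x
}.

(* Gamma_B(M): the elements annihilated by some power B^k, that is, by all
   products of k elements of B. *)
Definition torsion (B : set S) (M : gradedModule) : set M :=
  [set x | exists k : nat, forall b : 'I_k -> S,
     (forall j, B (b j)) -> (\prod_j b j) *: x = 0].

Section Cohomology.
Variables (B : set S) (I : nat -> gradedModule).
Variable d : forall i, {linear I i -> I i.+1}.

Definition torsion_cocycle (i : nat) : set (I i) :=
  [set x | torsion B x /\ d i x = 0].

Definition torsion_coboundary (i : nat) : set (I i) :=
  match i with
  | 0%N => [set 0]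
  | j.+1 => d j @` torsion B (M := I j)
  end.

End Cohomology.

(* H^i_B(M)_g = 0, where H^i_B is the i-th right derived functor of Gamma_B on
   G-graded modules.  The condition does not depend on the graded injective
   resolution, and such resolutions exist, as the category has enough
   injectives. *)
Definition local_cohomology_eq0 (B : set S) (M : gradedModule)
    (i : nat) (g : G) : Prop :=
  forall (I : nat -> gradedModule) (e : {linear M -> I 0%N})
    (d : forall j, {linear I j -> I j.+1}),
    is_injective_resolution e d ->
    torsion_cocycle B d (i := i) `&` piece g `<=` torsion_coboundary B d (i := i).

Definition reg (B : set S) (l : nat) (c : 'I_l -> G) (M : gradedModule) :
    set G :=
  [set m | forall (i : nat) (p : G),
     (m +: NCj c (1 - i%:Z)) p -> local_cohomology_eq0 B M i p].

Lemma homogZ g h (f x : S) : homogeneous g f -> homogeneous h x -> homogeneous (g + h) (f * x).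
Proof.
move=> hf hx m /msuppM_le /allpairsP[[m1 m2] /= [/hf <- /hx <- ->]].
rewrite /mon_degree -big_split; apply: eq_bigr => i _ /=.
by rewrite mnmDE mulrnDr.
Qed.

Lemma homog_span (f : S) : exists2 s : seq S,
  (forall y, y \in s -> exists g, homogeneous g y) & f = \sum_(y <- s) y.
Proof.
exists [seq f@_m *: 'X_[m] | m <- msupp f]; last by rewrite big_map -mpolyE.
move=> _ /mapP[m _ ->]; exists (mon_degree m) => m' /msuppZ_le.
by rewrite msuppX inE => /eqP ->.
Qed.

Lemma homogB g (x y : S) : homogeneous g x -> homogeneous g y -> homogeneous g (x - y).
Proof.
move=> hx hy m /msuppB_le; rewrite mem_cat => /orP[/hx|/hy] //.
Qed.

Lemma homog0 g : homogeneous g 0.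
Proof. by move=> m; rewrite msupp0. Qed.

Lemma homog_indep (s : seq G) (y : G -> S) : uniq s ->
  (forall g, homogeneous g (y g)) -> \sum_(g <- s) y g = 0 ->
  forall g, g \in s -> y g = 0.
Proof.
move=> us hy sy0 g gs; apply/mpolyP => m; rewrite mcoeff0.
have [mg|] := boolP (m \in msupp (y g)); last by rewrite mcoeff_msupp negbK => /eqP.
have := congr1 (mcoeff m) sy0.
rewrite mcoeff0 raddf_sum /= (bigD1_seq g) //= big1 ?addr0 // => h hg.
apply/eqP; rewrite -[_ == 0]negbK -mcoeff_msupp; apply: contra hg => mh.
by rewrite -(hy _ _ mg) -(hy _ _ mh).
Qed.

Definition gradedS : gradedModule :=
  @GradedModule (S^o : lmodType S) homogeneous homog0 homogB homogZ
    homog_span homog_indep.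

End GradedModules.

Section ListRegularity.
Variables (K : fieldType) (G : zmodType) (n : nat) (a : 'I_n -> G).
Variables (B : set {mpoly K[n]}) (l : nat) (c : 'I_l -> G).

Definition regS : set G := reg B c (gradedS K a).

Definition regJi (s : nat) (J : 'I_s.+1 -> set G) (i : nat) : set G :=
  [set m | m +: NCj c (1 - i%:Z) `<=`
     \bigcap_(p : 'I_s.+1) \bigcap_(d in J p)
       (d +: regS :+: NCj c (1 - i%:Z - (p : nat)%:Z))].

Definition regJ (s : nat) (J : 'I_s.+1 -> set G) : set G :=
  \bigcap_(i : nat) regJi J i.

End ListRegularity.

(* Main.v *)
(* Both inclusions rest on NC[j] + NC[k] <= NC[j + k] for j, k of equal sign.
   For p = 0 the condition with i = 1 implies all the others, and for p >= 1
   the one with i = 0 does: elements of NC[1] have the form c_j + u with u in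
   NC, and for i >= 1 one writes m = (m + c_j) - c_j, where -c_j lies in NC[-1]
   (this needs l >= 1). *)
Require Import Defs.
From mathcomp Require Import all_boot all_order all_algebra.
From mathcomp Require Import mpoly zify.
From mathcomp Require Import boolp classical_sets.

Local Open Scope classical_set_scope.
Local Open Scope ring_scope.

Set Implicit Arguments.
Unset Strict Implicit.
Unset Printing Implicit Defensive.

Import Order.TTheory GRing.Theory Num.Theory.

(** The shift [h] is absorbed by the second summand while the first is kept. With [A] the set
    [d +: R], this reduces the inclusion of the right-hand side to statements about [NCj] alone. *)
Lemma minkowskiDr (G : zmodType) (A B C : set G) (h x y : G) :
  (forall u, B u -> C (u + h)) -> (A :+: B) x -> y = x + h -> (A :+: C) y.
Proof.
by move=> BC [z Az [u Bu <-]] ->; exists z => //; exists (u + h); rewrite ?addrA //; exact: BC.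
Qed.

Lemma minkowski_translateB (G : zmodType) (A B : set G) (d g x : G) :
  ((d - g) +: A :+: B) x <-> (d +: A :+: B) (x + g).
Proof.
split=> -[_ [r Ar <-] [u Bu e]].
  exists (d + r); first by exists r.
  by exists u => //; rewrite -e [d - g + r]addrAC [_ - g + u]addrAC subrK.
exists (d - g + r); first by exists r.
by exists u => //; apply: (addIr g); rewrite -e [d - g + r]addrAC [_ - g + u]addrAC subrK.
Qed.

Section SemigroupFacts.
Variables (G : zmodType) (l : nat) (c : 'I_l -> G).

Lemma NC0 : NC c 0.
Proof. by move=> A [[A0 _] _]. Qed.

Lemma NCD x y : NC c x -> NC c y -> NC c (x + y).
Proof. by move=> Nx Ny A hA; case: (hA) => -[_ AD] _; apply: AD; [apply: Nx | apply: Ny]. Qed.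

Lemma NCjP j x : NCj c j x <-> exists (w : 'I_l -> nat) (u : G),
  [/\ (\sum_i w i)%N = absz j, NC c u & x = (\sum_i c i *+ w i) *~ sgz j + u].
Proof.
split=> [[w ws [u Nu <-]]|[w [u [ws Nu ->]]]]; first by exists w, u.
by exists w => //; exists u.
Qed.

Lemma NCj0 x : NC c x -> NCj c 0 x.
Proof. by move=> Nx; apply/NCjP; exists (fun=> 0%N), x; rewrite big1 // mulr0z add0r. Qed.

(** The weights are the indicator of [i]; [sgz j] treats [j = 1] and [j = -1] at once. *)
Lemma NCj_sgz i (j : int) : absz j = 1%N -> NCj c j (c i *~ sgz j).
Proof.
move=> j1; apply/NCjP; exists (fun k => (k == i) : nat), 0; split.
- by rewrite j1 (bigD1 i) //= eqxx big1 // => k /negPf ->.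
- exact: NC0.
- rewrite addr0 (bigD1 i) //= eqxx big1 ?addr0 // => k /negPf -> //.
Qed.

Lemma NCj1P x : NCj c 1 x -> exists i u, NC c u /\ x = c i + u.
Proof.
move=> /NCjP[w [u [/eqP/sum_nat_eq1[i [_ wi w0]] Nu ->]]].
exists i, u; split=> //; rewrite mulr1z (bigD1 i) //= wi big1 ?addr0 // => k ki.
by rewrite w0.
Qed.

(** Weight vectors add, and [0 <= j * k] gives |j| + |k| = |j + k|. *)
Lemma NCjD (j k : int) x y : 0 <= j * k ->
  NCj c j x -> NCj c k y -> NCj c (j + k) (x + y).
Proof.
move=> jk /NCjP[w [u [ws Nu ->]]] /NCjP[v [t [vs Nt ->]]].
apply/NCjP; exists (fun i => (w i + v i)%N), (u + t); split.
- by rewrite big_split /= ws vs; nia.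
- exact: NCD.
(* A zero index may have another sign than [j + k], but its weights all vanish, so the sign factor
   does not matter. *)
- have null (z : 'I_l -> nat) : (\sum_i z i = 0)%N -> \sum_i c i *+ z i = 0.
    by move=> /eqP; rewrite sum_nat_eq0 => /forallP z0; apply: big1 => i _; rewrite (eqP (z0 i)).
  under [in RHS]eq_bigr do rewrite mulrnDr.
  rewrite big_split /= mulrzDl addrACA; congr (_ + _).
  have [j0|j0] := eqVneq j 0.
    by rewrite null ?ws ?j0 // !mul0rz !add0r.
  have [k0|k0] := eqVneq k 0.
    by rewrite [X in _ + X *~ _ = _ + X *~ _]null ?vs ?k0 // !mul0rz !addr0.
  have [sj sk] : sgz j = sgz (j + k) /\ sgz k = sgz (j + k).
    have [[j_gt0 k_gt0]|[j_lt0 k_lt0]] : (0 < j /\ 0 < k) \/ (j < 0 /\ k < 0) by nia.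
      by rewrite !gtr0_sgz; lia.
    by rewrite !ltr0_sgz; lia.
  by rewrite sj sk.
Qed.

End SemigroupFacts.

Theorem theorem3p12 (K : fieldType) (G : zmodType)
    (hG : finitely_generated G) (n : nat) (a : 'I_n -> G)
    (B : set {mpoly K[n]}) (hB : is_graded_ideal a B)
    (s : nat) (J : 'I_s.+1 -> set G)
    (l : nat) (hl : (1 <= l)%N) (c : 'I_l -> G) :
  regJ a B c J =
    (\bigcap_(d in J ord0) (d +: regS a B c :+: NCj c 0))
    `&`
    (\bigcap_(p in [set p : 'I_s.+1 | (1 <= p)%N])
       \bigcap_(d in J p)
         \bigcap_(j : 'I_l)
           ((d - c j) +: regS a B c :+: NCj c (1 - (p : nat)%:Z))).
Proof.
set R := regS a B c; apply/seteqP; split=> [m regm|m [Xm Ym] i _ _ [x Nx <-] p _ d Jd].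
  split=> [d Jd|p p_gt0 d Jd j _].
    (* At [i = 1] the set NC[1 - i] is NC[0], which contains 0. *)
    have m0 : (m +: NCj c (1 - 1%N%:Z)) m by exists 0; [exact: NCj0 (@NC0 _ _ c) | rewrite addr0].
    exact: (regm 1%N I m m0 ord0 I d Jd).
  apply/minkowski_translateB; apply: (regm 0%N I _ _ p I d Jd).
  by exists (c j) => //; apply: (@NCj_sgz _ _ c j 1).
have [p0|p_gt0] := posnP p.
  have {}p0 : p = ord0 by apply/val_inj.
  rewrite p0 in Jd *; apply: minkowskiDr (Xm d Jd) erefl => u Nu.
  (* One index is 0, so [NCjD] applies whatever the sign of [1 - i]. *)
  by rewrite subr0 -[1 - _]add0r; apply: NCjD; rewrite ?mul0r.
have {}Ym j : (d +: R :+: NCj c (1 - p%:Z)) (m + c j).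
  by apply/minkowski_translateB; exact: Ym.
case: i Nx => [|i] Nx.
  (* The generator [c j] depends on [x], so [Ym] is needed for every [j]. *)
  rewrite subr0 in Nx *; have [j [u [Nu ->]]] := NCj1P Nx.
  apply: minkowskiDr (Ym j) (addrA _ _ _) => v Nv.
  by rewrite -[1 - _]addr0; apply: NCjD => //; [rewrite mulr0 | exact: NCj0].
(* Here any one generator suffices. *)
pose j := Ordinal hl.
have Ncj : NCj c (-1) (- c j) by have := @NCj_sgz _ _ c j (-1) erefl.
apply: (minkowskiDr (h := - c j + x) _ (Ym j)); last by rewrite addrA addrK.
move=> v Nv.
have -> : 1 - i.+1%:Z - (p : nat)%:Z = 1 - (p : nat)%:Z + (-1 + (1 - i.+1%:Z)) by lia.
(* As [p >= 1], the indices [1 - p], [-1] and [1 - i.+1] are all nonpositive. *)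
by apply: NCjD => //; [nia | apply: NCjD => //; nia].
Qed.
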